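(* If $\mathfrak d$ is an even dimensional complex or real reductive Lie algebra and $\langle\,,\rangle$ is a nondegenerate symmetric invariant bilinear form on $\mathfrak d$, then for all Lagrangian subalgebras $\mathfrak l$ of $(\mathfrak d,\langle\,,\rangle)$, $$[\mathfrak n(\mathfrak l),\mathfrak n(\mathfrak l)]=(\mathfrak n(\mathfrak l))^\perp .$$
   Context: For a subspace $V\subset\mathfrak d$, $V^\perp=\{x\in\mathfrak d\mid\langle x,y\rangle=0\ \forall y\in V\}$. A Lie subalgebra $\mathfrak l$ of $\mathfrak d$ is Lagrangian if $\mathfrak l^\perp=\mathfrak l$. $\mathfrak n(\mathfrak l)$ denotes the normalizer subalgebra of $\mathfrak l$ in $\mathfrak d$. *)

(* Defs.v *)
From HB Require Import structures.
From mathcomp Require Import all_boot all_order all_algebra.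
From mathcomp Require Import sesquilinear.

Set Implicit Arguments.
Unset Strict Implicit.
Unset Printing Implicit Defensive.

Import GRing.Theory.
Local Open Scope ring_scope.

HB.mixin Record Vector_isLieAlgebra (K : fieldType) L & Vector K L := {
  lie : L -> L -> L;
  lie_linearl : forall y, linear (lie ^~ y);
  lie_linearr : forall x, linear (lie x);
  liexx : forall x, lie x x = 0;
  lie_jacobi : forall x y z,
    lie x (lie y z) + lie y (lie z x) + lie z (lie x y) = 0
}.

#[short(type="lieAlgType")]
HB.structure Definition LieAlgebra (K : fieldType) :=
  { L of Vector_isLieAlgebra K L & Vector K L }.

Reserved Notation "[lie x , y ]"
  (at level 0, x, y at level 99, format "[lie  x ,  y ]").
Notation "[lie x , y ]" := (lie x y) : ring_scope.

Section LieAlgebraTheory.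

Variables (K : fieldType) (d : lieAlgType K).
Implicit Types (x y z : d) (U V W l : {vspace d}).

HB.instance Definition _ := bilinear_isBilinear.Build K d d d *:%R *:%R
  (@lie K d) (@lie_linearl K d, @lie_linearr K d).

Definition lie_subalgebra U := {in U &, forall x y, [lie x, y] \in U}.

Definition lie_ideal U := forall x, {in U, forall y, [lie x, y] \in U}.

(* The linear span of the brackets [lie x, y] with x in U and y in V; written
   with bases as prodv is for algebras, see liev_sub. *)
Definition liev U V : {vspace d} :=
  <<[seq [lie x, y] | x <- vbasis U, y <- vbasis V]>>%VS.

(* The x such that [lie x, y] is in l for all y in l, see memv_lie_normv. *)
Definition lie_normv l : {vspace d} :=
  (\bigcap_(i < \dim l) (linfun (applyr (@lie K d) (vbasis l)`_i) @^-1: l))%VS.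

Lemma memv_lie U V x y : x \in U -> y \in V -> [lie x, y] \in liev U V.
Proof.
move=> /coord_vbasis -> /coord_vbasis ->.
rewrite linear_sumr; apply: memv_suml => j _.
rewrite linear_sumlz; apply: memv_suml => i _.
rewrite linearZr_LR linearZl_LR /= !memvZ // memv_span //.
apply/allpairsP; exists ((vbasis U)`_i, (vbasis V)`_j).
by rewrite /= !mem_nth ?size_tuple.
Qed.

Lemma liev_sub U V W :
  reflect {in U & V, forall x y, [lie x, y] \in W} (liev U V <= W)%VS.
Proof.
apply: (iffP idP) => [sW x y xU yV | UVW].
  exact/(subvP sW)/memv_lie.
apply/span_subvP => _ /allpairsP[[x y] [/= xU yV ->]].
by apply: UVW; apply: vbasis_mem.
Qed.

Lemma memv_lie_normv l x :
  reflect {in l, forall y, [lie x, y] \in l} (x \in lie_normv l).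
Proof.
rewrite /lie_normv memvE; apply: (iffP subv_bigcapP) => [xN y yl | xN i _].
  rewrite (coord_vbasis yl) linear_sumr; apply: memv_suml => i _.
  rewrite linearZr_LR memvZ //.
  by have := xN i isT; rewrite -memvE -memv_preim lfunE.
by rewrite -memvE -memv_preim lfunE; apply/xN/vbasis_mem/mem_nth; rewrite size_tuple.
Qed.

Definition invariant_form (form : d -> d -> K) :=
  forall x y z, form [lie x, y] z = form x [lie y, z].

Definition lagrangian (form : {symmetric d}) l :=
  lie_subalgebra l /\ orthov form l = l.

End LieAlgebraTheory.

(* Complete reducibility of the adjoint representation. *)
Definition reductive (K : fieldType) (d : lieAlgType K) :=
  forall U : {vspace d}, lie_ideal U ->
  exists V : {vspace d},
    [/\ lie_ideal V, (U + V)%VS = fullv & (U :&: V)%VS = 0%VS].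

(* Main.v *)
(** Write [n] for the normalizer of [l] and [K] for the trace form of the
    adjoint representation of [d]. Invariance and [l^perp = l] give
    [n = [l,l]^perp], so that [n^perp = [l,l]] is contained in [[n,n]]; the
    point is that [[n,n]] is contained in [n^perp].

    Let [m] be an ideal of [n] and [c] the [K]-orthogonal of [[m,m]] in [m].
    Cartan's criterion and Engel's theorem show successively that [[c,c]],
    [[n,c]] and [[m,m] /\ c] act nilpotently on [d]. The last fact says that the
    radical of [K] on [[m,m]] is [K]-orthogonal to [m], whence [m = [m,m] + c].
    On [[d,d]] the form is [K (phi x) y] for some [phi] commuting with the
    adjoint action, because [d] is reductive; hence an ideal of [n] acting
    nilpotently and contained in [[d,d]] lies in [n^perp]. Therefore
    [[n,m]] is contained in [[n,[m,m]] + n^perp].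

    For [m = l] this reads [[n,l]] in [n^perp], hence [[n,n]] in [l^perp = l];
    then [m = n] gives [[n,n]] in [[n,[n,n]] + n^perp], which is contained in
    [[n,l] + n^perp = n^perp]. *)

From HB Require Import structures.
Require Import Defs.
From mathcomp Require Import all_boot all_order all_algebra ring.
From mathcomp Require Import sesquilinear reals complex.

Set Implicit Arguments.
Unset Strict Implicit.
Unset Printing Implicit Defensive.

Import GRing.Theory Num.Theory VectorInternalTheory.
Local Open Scope ring_scope.

(** * Trace criteria for nilpotent matrices *)

(** Chinese remainder theorem for the moduli [('X - r%:P) ^+ N]: for a new root [a], the Bezout
    relation [u * ('X - a%:P) ^+ N + v * M = 1] makes [v * M] the idempotent at [a] and multiplies
    the others by [u * ('X - a%:P) ^+ N]. *)
Lemma poly_crt_idempotents (F : fieldType) (N : nat) (rs : seq F) : uniq rs ->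
  exists e : F -> {poly F},
    [/\ \prod_(r <- rs) ('X - r%:P) ^+ N %| \sum_(r <- rs) e r - 1,
        {in rs, forall r,
           \prod_(s <- rs) ('X - s%:P) ^+ N %| ('X - r%:P) ^+ N * e r}
      & {in rs &, forall r s, r != s -> ('X - r%:P) ^+ N %| e s}].
Proof.
elim: rs => [|a rs IHrs] /=.
  by exists (fun=> 0); split=> //; rewrite !big_nil dvd1p.
case/andP=> a_rs /IHrs[e [e1 er ers]].
set M := \prod_(r <- rs) _ in e1 er.
have /Bezout_eq1_coprimepP[[u v] /= uv] : coprimep (('X - a%:P) ^+ N) M.
  rewrite /M; elim: (rs) a_rs => [_|b s IHs].
    by rewrite big_nil coprimep1.
  rewrite inE negb_or => /andP[ab /IHs a_s].
  rewrite big_cons coprimepMr a_s andbT coprimep_expl ?coprimep_expr //.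
  by rewrite coprimep_XsubC root_XsubC eq_sym.
have a_neq r : r \in rs -> (r == a) = false.
  by move=> r_rs; apply: contraNF a_rs => /eqP <-.
exists (fun r => if r == a then v * M else u * ('X - a%:P) ^+ N * e r); split.
- rewrite !big_cons eqxx -/M.
  rewrite (eq_big_seq (fun r => u * ('X - a%:P) ^+ N * e r)); last first.
    by move=> r /a_neq ->.
  have -> : v * M + \sum_(r <- rs) u * ('X - a%:P) ^+ N * e r - 1 =
      u * ('X - a%:P) ^+ N * (\sum_(r <- rs) e r - 1).
    by rewrite -mulr_sumr (canRL (addKr _) uv); ring.
  by rewrite dvdp_mul ?dvdp_mull.
- move=> r; rewrite inE big_cons -/M; have [-> _|_ /= r_rs] := eqVneq r a.
    by rewrite mulrCA dvdp_mull.
  by rewrite mulrCA dvdp_mul ?er // dvdp_mull.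
- move=> r s; rewrite !inE /=; case: (eqVneq s a) => [-> | sa] /=; last first.
    case: (eqVneq r a) => [-> | ra] /= r_rs s_rs rs_neq; last first.
      by rewrite dvdp_mull // ers.
    by rewrite mulrAC dvdp_mull.
  case: (eqVneq r a) => [-> | ra] /= r_rs _; rewrite ?eqxx // => _.
  by rewrite dvdp_mull // /M (big_rem r) //= dvdp_mulr.
Qed.

Lemma poly_interpolation (F : fieldType) (N : nat) (rs : seq F) (f : F -> F) :
  exists q : {poly F}, {in rs, forall r, ('X - r%:P) ^+ N %| q - (f r)%:P}.
Proof.
have [e [e1 er ers]] := poly_crt_idempotents N (undup_uniq rs).
exists (\sum_(s <- undup rs) (f s)%:P * e s) => r r_rs.
have -> : \sum_(s <- undup rs) (f s)%:P * e s - (f r)%:P =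
    \sum_(s <- undup rs) ((f s)%:P - (f r)%:P) * e s +
      (f r)%:P * (\sum_(s <- undup rs) e s - 1).
  under [in RHS]eq_bigr do rewrite mulrBl.
  by rewrite sumrB -mulr_sumr; ring.
rewrite dvdp_add ?dvdp_mull //.
  rewrite big_seq; apply: (big_ind (fun p => _ %| p)) => [|p q|s s_rs].
  - exact: dvdp0.
  - exact: dvdp_add.
  have [-> | rs_neq] := eqVneq r s; first by rewrite subrr mul0r dvdp0.
  by rewrite dvdp_mull // ers // mem_undup.
apply: dvdp_trans e1.
by rewrite (big_rem r) ?mem_undup //= dvdp_mulr.
Qed.

(** Cancelling the outer factors of the rank factorization in [A *m A = A] leaves an identity matrix
    of size the rank. *)
Lemma mxtrace_idempotent (F : fieldType) n (A : 'M[F]_n) :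
  A *m A = A -> \tr A = (\rank A)%:R.
Proof.
move=> AA; rewrite -{1}(mulmx_base A) mxtrace_mulC.
suff -> : row_base A *m col_base A = 1%:M by rewrite mxtrace1.
apply: (row_full_inj (col_base_full A)).
apply: (row_free_inj (row_base_free A)).
by rewrite mulmx1 mulmxA -mulmxA !mulmx_base AA.
Qed.

Lemma expr_mulmxC (R : pzSemiRingType) m n (A : 'M[R]_(m, n))
    (B : 'M[R]_(n, m)) k :
  (A *m B) ^+ k.+1 = A *m (B *m A) ^+ k *m B.
Proof.
elim: k => [|k IHk]; first by rewrite expr1 expr0 mulmx1.
by rewrite exprS IHk exprS -!mulmxE !mulmxA.
Qed.

(* The trace of [A = C *m R] is that of [R *m C], which is again nilpotent and
   has size the rank of [A]: induct on the size. *)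
Lemma mxtrace_nilpotent (F : fieldType) n (A : 'M[F]_n) k :
  A ^+ k = 0 -> \tr A = 0.
Proof.
elim: n {-2}n (leqnn n) A k => [|m IHm] n.
  by rewrite leqn0 => /eqP -> A k _; rewrite /mxtrace big_ord0.
move=> n_le A k Ak.
have [A_full | A_nfull] := eqVneq (\rank A) n.
  have A_unit : A \in unitmx by rewrite -row_full_unit /row_full A_full.
  have /eqP : \rank (A ^+ k) = 0%N by rewrite Ak mxrank0.
  have -> : \rank (A ^+ k) = n.
    elim: k {Ak} => [|k IHk]; first by rewrite expr0 mxrank1.
    by rewrite exprSr mxrankMfree ?row_free_unit.
  move=> /eqP n0; rewrite /mxtrace big1 // => i _.
  by have := ltn_ord i; rewrite {2}n0.
rewrite -(mulmx_base A) mxtrace_mulC.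
apply: (IHm _ _ _ k.+1).
  by rewrite -ltnS (leq_trans _ n_le) // ltn_neqAle A_nfull rank_leq_row.
by rewrite expr_mulmxC mulmx_base Ak mulmx0 mul0mx.
Qed.

(** The [E r] are the projections onto the generalized eigenspaces of [X], written as polynomials in
    [X]. *)
Lemma spectral_idempotents (F : closedFieldType) n (X : 'M[F]_n.+1) :
  exists (N : nat) (rs : seq F) (e : F -> {poly F}),
    let E r := horner_mx X (e r) in
    [/\ uniq rs, \sum_(r <- rs) E r = 1,
        {in rs, forall r, (X - r%:M) ^+ N.+1 * E r = 0}
      & {in rs &, forall r s, E r * E s = if r == s then E r else 0}].
Proof.
have [s ps] := closed_field_poly_normal (char_poly X).
have [e [e1 er ers]] := poly_crt_idempotents (size s).+1 (undup_uniq s).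
(* The exponent exceeds every multiplicity, so the product is a multiple of [char_poly X] and
   Cayley-Hamilton applies. *)
have chi0 p : \prod_(r <- undup s) ('X - r%:P) ^+ (size s).+1 %| p ->
    horner_mx X p = 0.
  move=> chip; apply/eqP; rewrite -dvd_mxminpoly; apply: dvdp_trans chip.
  apply: dvdp_trans (mxminpoly_dvd_char X) _.
  rewrite ps dvdpZl ?lead_coef_eq0 ?monic_neq0 ?char_poly_monic //.
  rewrite -big_undup_iterop_count; elim: (undup s) => [|r t IHt].
    by rewrite !big_nil dvdpp.
  rewrite !big_cons dvdp_mul // -[iterop _ _ _ _]/(_ ^+ _).
  by rewrite dvdp_exp2l // ltnW // ltnS count_size.
pose E r := horner_mx X (e r).
have EE : {in undup s &, forall r t, r != t -> E r * E t = 0}.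
  move=> r t r_s t_s rt /=; rewrite -rmorphM; apply: chi0.
  have /dvdpP[q ->] := ers _ _ r_s t_s rt.
  by rewrite mulrCA dvdp_mull // mulrC er.
have E1 : \sum_(r <- undup s) E r = 1.
  apply/eqP; rewrite -raddf_sum /= -subr_eq0.
  by rewrite -(rmorph1 (horner_mx X)) -rmorphB; apply/eqP/chi0.
exists (size s), (undup s), e; split=> [|//||r t r_s t_s].
- exact: undup_uniq.
- move=> r r_s /=.
  have <- : horner_mx X (('X - r%:P) ^+ (size s).+1 * e r) =
     (X - r%:M) ^+ (size s).+1 * horner_mx X (e r).
    by rewrite rmorphM rmorphXn rmorphB /= horner_mx_X horner_mx_C.
  exact/chi0/er.
case: eqVneq => [<-|]; last exact: EE.
rewrite -[RHS]mulr1 -[1 in RHS]E1 mulr_sumr (bigD1_seq r) ?undup_uniq //=.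
rewrite [X in _ = _ + X]big_seq_cond big1 ?addr0 // => u /andP[u_s ur].
by rewrite EE // eq_sym.
Qed.

(* Interpolating [f] at the eigenvalues [nu i] gives a polynomial [q], without
   constant term, such that [q] of [D] acts on [v i] as [f (nu i)]. *)
Lemma eigen_sum_eq0 (F : fieldType) (f : F -> F) m (D : 'M[F]_m) N p
    (w : 'M[F]_(m, p)) (I : eqType) (r : seq I) (v : I -> 'rV[F]_m)
    (nu : I -> F) :
  f 0 = 0 ->
  {in r, forall i, v i *m (D - (nu i)%:M) ^+ N = 0} ->
  (forall k, \sum_(i <- r) v i *m D ^+ k.+1 *m w = 0) ->
  \sum_(i <- r) f (nu i) *: (v i *m w) = 0.
Proof.
case: m => [|m] in D w v *.
  by move=> _ _ _; apply: big1 => i _; rewrite [v i]thinmx0 mul0mx scaler0.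
move=> f0 vN vD.
(* The node [0] serves to make ['X] divide [q]; the exponent [N.+1] ensures this even for
   [N = 0]. *)
have [q qP] := poly_interpolation N.+1 (0 :: map nu r) f.
have [q' qE] : exists q', q = q' * 'X.
  apply/dvdpP; have := qP 0; rewrite inE eqxx f0 subr0 subr0 => /(_ isT).
  by apply: dvdp_trans; rewrite exprS dvdp_mulr.
have vq i : i \in r -> f (nu i) *: (v i *m w) = v i *m horner_mx D q *m w.
  move=> i_r.
  have /dvdpP[g gE] := qP (nu i) (mem_behead (s := _ :: _) (map_f nu i_r)).
  rewrite -(subrK (f (nu i))%:P q) gE exprS mulrCA mulrA mulrC.
  rewrite rmorphD !rmorphM rmorphXn rmorphB /= horner_mx_X !horner_mx_C.
  rewrite mulmxDr -!mulmxE !mulmxA vN // !mul0mx add0r.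
  by rewrite mul_mx_scalar scalemxAl.
rewrite big_seq (eq_bigr _ vq) -big_seq qE rmorphM /= horner_mx_X.
rewrite -[q']coefK poly_def rmorph_sum /=.
under eq_bigr do rewrite mulr_suml mulmx_sumr mulmx_suml.
rewrite exchange_big big1 //= => k _.
under eq_bigr do
  rewrite -mul_polyC rmorphM rmorphXn /= horner_mx_C horner_mx_X -mulrA
    -exprSr -mulmxE mul_scalar_mx -scalemxAr -scalemxAl.
by rewrite -scaler_sumr vD scaler0.
Qed.

(** Presents the trace against [A] as multiplication by a column, the shape of [w] in
    [eigen_sum_eq0]. *)
Lemma mxvec_trmx_mul (R : comPzSemiRingType) m n (A : 'M[R]_(n, m))
    (B : 'M[R]_(m, n)) : mxvec B *m (mxvec A^T)^T = (\tr (A *m B))%:M.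
Proof.
rewrite [LHS]mx11_scalar; congr (_%:M); rewrite mxtrace_mulC mxE.
rewrite (reindex _ (curry_mxvec_bij _ _)) /=.
rewrite [LHS](eq_bigr (fun ij => B ij.1 ij.2 * A ij.2 ij.1)) => [|[i j] _].
  rewrite -(pair_bigA _ (fun i j => B i j * A j i)).
  by apply: eq_bigr => i _; rewrite mxE.
by rewrite mxE /= !mxvecE mxE.
Qed.

(* [S] is the complex conjugate of the semisimple part of [X]: it has the
   generalized eigenspaces of [X] with conjugate eigenvalues, so [\tr (X * S)]
   is a sum of squared moduli, and its commutator map is a polynomial without
   constant term in that of [X]. *)
Lemma conjugate_part (C : numClosedFieldType) n (X : 'M[C]_n.+1) :
  exists p : {poly C}, let S := horner_mx X p in
    (\tr (X * S) = 0 -> exists k, X ^+ k = 0) /\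
    (forall A B : 'M_n.+1,
       (forall k, \tr (A * iter k.+1 (fun M => X * M - M * X) B) = 0) ->
       \tr (A * (S * B - B * S)) = 0).
Proof.
have [N [rs [e]]] := spectral_idempotents X.
set E := fun r => horner_mx X (e r); cbv zeta; case=> rs_uniq E1 EX EE.
exists (\sum_(r <- rs) r^* *: e r); set S := horner_mx _ _ => /=.
have SE : S = \sum_(r <- rs) r^* *: E r.
  by rewrite /S rmorph_sum /=; apply: eq_bigr => r _; rewrite linearZ.
have XE r : GRing.comm (X - r%:M) (E r).
  rewrite -(horner_mx_C X) -{1}(horner_mx_X X) -rmorphB.
  exact: comm_horner_mx2.
split.
  have trXE r : r \in rs -> \tr (X * E r) = r * (\rank (E r))%:R.
    move=> r_rs; rewrite -{1}(subrK r%:M X) mulrDl linearD /=.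
    rewrite (@mxtrace_nilpotent _ _ _ N.+1) ?add0r.
      rewrite -[r%:M * _]/(_ *m _) mul_scalar_mx linearZ /=.
      rewrite mxtrace_idempotent //.
      by have := EE r r r_rs r_rs; rewrite eqxx.
    by rewrite exprMn_comm // [E r ^+ _]exprS mulrA EX // mul0r.
  rewrite SE mulr_sumr linear_sum /= big_seq.
  under eq_bigr => r r_rs do
    rewrite -scalerAr linearZ /= trXE // mulrA (mulrC _ r).
  (* The trace is a sum of terms [r * r^*] times a rank, all nonnegative, so each [r] with [E r]
     nonzero is zero. *)
  rewrite -big_seq => /eqP; rewrite psumr_eq0; last first.
    by move=> r _; rewrite mulr_ge0 ?ler0n // mul_conjC_ge0.
  move=> /allP /= E0; exists N.+1.
  rewrite -[LHS]mulr1 -E1 mulr_sumr big_seq big1 // => r r_rs.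
  have := E0 r r_rs; rewrite mulf_eq0 mul_conjC_eq0 pnatr_eq0 mxrank_eq0.
  by case/orP=> /eqP r0; rewrite r0 ?mulr0 // -(EX r) // r0 raddf0 subr0.
move=> A B trAB.
pose D := lin_mulmx X - lin_mulmxr X.
have DE k M : mxvec M *m D ^+ k = mxvec (iter k (fun M => X * M - M * X) M).
  elim: k => [|k IHk]; first by rewrite expr0 mulmx1.
  by rewrite exprSr mulmxA IHk mulmxBr !mul_vec_lin -linearB.
have wE M := mxvec_trmx_mul A M; set w := (mxvec A^T)^T in wE.
pose rs2 := [seq (a, b) | a <- rs, b <- rs].
pose v ab := mxvec (E ab.1 * B * E ab.2).
have BE : B = \sum_(ab <- rs2) E ab.1 * B * E ab.2.
  rewrite big_allpairs /= -[LHS]mul1r -[LHS]mulr1 -{1}E1 -E1 !mulr_suml.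
  by apply: eq_bigr => a _; rewrite mulr_sumr.
have vD k : \sum_(ab <- rs2) v ab *m D ^+ k.+1 *m w = 0.
  rewrite -!mulmx_suml -linear_sum -BE DE wE.
  by have := trAB k; rewrite -mulmxE => ->; rewrite raddf0.
(* On the block of [(a, b)], [D - (a - b)%:M] is a difference of two commuting maps whose powers
   [N.+1] vanish there; each term of the binomial expansion contains one of these powers. *)
have vN : {in rs2, forall ab,
    v ab *m (D - (ab.1 - ab.2)%:M) ^+ (N.+1 + N.+1) = 0}.
  case=> _ _ /allpairsP[[a b] [/= a_rs b_rs [-> ->]]].
  rewrite /v /=; set M := E a * B * E b.
  pose L := lin_mulmx (X - a%:M) : 'M_(n.+1 * n.+1).
  pose Rb := lin_mulmxr (X - b%:M) : 'M_(n.+1 * n.+1).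
  have ext (P Q : 'M[C]_(n.+1 * n.+1)) :
      (forall M', mxvec M' *m P = mxvec M' *m Q) -> P = Q.
    move=> PQ; apply/row_matrixP => i.
    by rewrite !rowE -[delta_mx 0 i]vec_mxK PQ.
  have -> : D - (a - b)%:M = L - Rb.
    apply: ext => M'; rewrite !mulmxBr mul_mx_scalar !mul_vec_lin.
    rewrite -!linearB -linearZ -!linearB /=; congr mxvec.
    rewrite mulmxBl mulmxBr mul_scalar_mx mul_mx_scalar scalerBl.
    move: (X *m M') (M' *m X) => P Q.
    by apply/matrixP => i j; rewrite !mxE; ring.
  have LR : GRing.comm L Rb.
    by apply: ext => M'; rewrite -!mulmxE !mulmxA !mul_vec_lin /= mulmxA.
  have LE k M' : mxvec M' *m L ^+ k = mxvec ((X - a%:M) ^+ k * M').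
    elim: k => [|k IHk]; first by rewrite !expr0 mulmx1 mul1r.
    by rewrite exprSr mulmxA IHk mul_vec_lin /= exprS -mulrA.
  have RE k M' : mxvec M' *m Rb ^+ k = mxvec (M' * (X - b%:M) ^+ k).
    elim: k => [|k IHk]; first by rewrite !expr0 mulmx1 mulr1.
    by rewrite exprSr mulmxA IHk mul_vec_lin /= exprSr mulrA.
  rewrite exprBn_comm // mulmx_sumr big1 // => i _.
  rewrite -mulrA -signr_odd mulr_sign (raddfMn (mulmx _)) /=.
  suff v0 : mxvec M *m (L ^+ (N.+1 + N.+1 - i) * Rb ^+ i) = 0.
    by case: odd; rewrite ?mulmxN v0 ?oppr0 mul0rn.
  rewrite -mulmxE mulmxA LE RE.
  have [iN | Ni] := leqP i N.+1.
    rewrite -addnBAC // exprD /M !mulrA -(mulrA _ ((X - a%:M) ^+ N.+1)) EX //.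
    by rewrite mulr0 !mul0r linear0.
  rewrite -(subnKC (ltnW Ni)) exprD /M !mulrA -(mulrA _ (E b)).
  by rewrite (commrX N.+1 (commr_sym (XE b))) EX // mulr0 mul0r linear0.
have SEr a : a \in rs -> S * E a = a^* *: E a.
  move=> a_rs; rewrite SE mulr_suml (bigD1_seq a) //= -scalerAl EE // eqxx.
  rewrite big_seq_cond big1 ?addr0 // => r /andP[r_rs /negPf ra].
  by rewrite -scalerAl EE // ra scaler0.
have ErS a : a \in rs -> E a * S = a^* *: E a.
  move=> a_rs; rewrite SE mulr_sumr (bigD1_seq a) //= -scalerAr EE // eqxx.
  rewrite big_seq_cond big1 ?addr0 // => r /andP[r_rs /negPf ra].
  by rewrite -scalerAr EE // eq_sym ra scaler0.
have SBE : S * B - B * S =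
    \sum_(ab <- rs2) (ab.1 - ab.2)^* *: (E ab.1 * B * E ab.2).
  rewrite {1 2}BE mulr_sumr mulr_suml -sumrB; apply: eq_big_seq.
  case=> _ _ /allpairsP[[a b] [/= a_rs b_rs [-> ->]]] /=.
  rewrite !mulrA SEr // -(mulrA _ (E b)) ErS //.
  by rewrite -!scalerAl -scalerAr -scalerBl rmorphB.
(* Commutation with [S] multiplies the block of [(a, b)] by [(a - b)^*], the conjugate of the
   eigenvalue of [D]. *)
have := eigen_sum_eq0 (conjC0 C) vN vD.
under eq_bigr do rewrite scalemxAl -linearZ.
rewrite -mulmx_suml -linear_sum -SBE wE => /(congr1 (fun M : 'M_1 => M 0 0)).
by rewrite !mxE eqxx.
Qed.

Definition nilpotent_mx (F : fieldType) n (X : 'M[F]_n) := exists k, X ^+ k = 0.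

Lemma map_mx_expn (R S : pzSemiRingType) (f : {rmorphism R -> S}) n
    (X : 'M[R]_n) k :
  map_mx f (X ^+ k) = map_mx f X ^+ k.
Proof.
elim: k => [|k IHk]; first by rewrite !expr0 map_mx1.
by rewrite !exprS -!mulmxE map_mxM IHk.
Qed.

Lemma nilpotent_map_mx (F C : fieldType) (f : {rmorphism F -> C}) n
    (X : 'M[F]_n) :
  nilpotent_mx (map_mx f X) -> nilpotent_mx X.
Proof.
by case=> k Xk; exists k; apply/eqP; rewrite -(map_mx_eq0 f) map_mx_expn Xk.
Qed.

Section TraceCriteria.
Variables (F : fieldType) (C : numClosedFieldType) (f : {rmorphism F -> C}).

(** Over [C] the conjugate part [S] is a polynomial in [X], so [\tr (X * S)] is a combination of
    traces of positive powers. *)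
Lemma nilpotent_mxtrace_exp n (X : 'M[F]_n) :
  (forall k, \tr (X ^+ k.+1) = 0) -> nilpotent_mx X.
Proof.
case: n X => [|n] X trX; first by exists 0%N; apply: thinmx0.
apply: (@nilpotent_map_mx _ _ f).
have [p [/= nilX _]] := conjugate_part (map_mx f X); apply: nilX.
rewrite -[p]coefK poly_def rmorph_sum mulr_sumr linear_sum big1 // => i _.
rewrite /= linearZ rmorphXn /= horner_mx_X -scalerAr linearZ -exprS.
rewrite -map_mx_expn.
by rewrite /= trace_map_mx trX rmorph0 mulr0.
Qed.

(** Linear algebra of Cartan's criterion: by cyclicity the trace of a commutator times [S] is, up to
    sign, [\tr (a * (S * b - b * S))], to which the second half of [conjugate_part] applies. *)
Lemma nilpotent_mx_commutators n (X : 'M[F]_n) (s : seq ('M[F]_n * 'M[F]_n)) :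
  X = \sum_(ab <- s) (ab.1 *m ab.2 - ab.2 *m ab.1) ->
  {in s, forall ab k,
    \tr (ab.1 *m iter k.+1 (fun M => X *m M - M *m X) ab.2) = 0} ->
  nilpotent_mx X.
Proof.
case: n X s => [|n] X s XE trX; first by exists 0%N; apply: thinmx0.
apply: (@nilpotent_map_mx _ _ f); have [p] := conjugate_part (map_mx f X).
case; set S := horner_mx _ p => nilX comX; apply: nilX.
rewrite {1}XE raddf_sum /= mulr_suml linear_sum big_seq.
rewrite big1 // => -[a b] ab_s /=.
have iterE k : map_mx f (iter k (fun M => X *m M - M *m X) b) =
    iter k (fun M => map_mx f X * M - M * map_mx f X) (map_mx f b).
  by elim: k => //= k <-; rewrite map_mxB !map_mxM.
have /eqP : \tr (map_mx f a * (S * map_mx f b - map_mx f b * S)) = 0.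
  apply: comX => k.
  rewrite -[_ * _]/(_ *m _) -[X in _ *m X](iterE k.+1) -map_mxM.
  by rewrite trace_map_mx (trX _ ab_s) rmorph0.
rewrite -oppr_eq0 => /eqP <-.
rewrite map_mxB !map_mxM -!mulmxE mulmxBl mulmxBr.
rewrite !(raddfB (mxtrace (n := _))) /= opprB !mulmxA.
by congr (_ - _); rewrite -[in LHS]mulmxA [LHS]mxtrace_mulC.
Qed.
End TraceCriteria.

(** * Orthogonality for symmetric forms *)

Section SymmetricForms.
Variables (K : fieldType) (V : vectType K) (form : {symmetric V}).
Implicit Types U : {vspace V}.

Lemma symformC u v : form u v = form v u.
Proof. by rewrite hermC expr0 mul1r. Qed.

(** The form may be degenerate on [U]. The row [c] of values of [g] lies in the row space of the
    Gram matrix [G] because the columns of [cokermx G] are coordinates of radical vectors, where [g]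
    vanishes. *)
Lemma symform_represent U (g : {scalar V}) :
  {in U, forall r, {in U, forall u, form u r = 0} -> g r = 0} ->
  exists2 b, b \in U & {in U, forall u, form b u = g u}.
Proof.
move=> gU; pose X := vbasis U.
pose G := \matrix_(i < \dim U, j < \dim U) form X`_i X`_j.
pose c := \row_(j < \dim U) g X`_j.
have XU (i : 'I_(\dim U)) : X`_i \in U.
  by rewrite vbasis_mem // mem_nth // size_tuple.
have /submxP[b bG] : (c <= G)%MS.
  rewrite submxE; apply/eqP/rowP => j; rewrite [RHS]mxE mxE.
  pose r := \sum_k cokermx G k j *: X`_k.
  transitivity (g r).
    rewrite linear_sum; apply: eq_bigr => k _; rewrite linearZ_LR /= mulrC.
    by congr (_ * _); rewrite mxE.
  apply: gU => [|u /coord_vbasis ->].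
    by apply: memv_suml => k _; rewrite memvZ.
  rewrite linear_sumlz big1 // => i _; rewrite linearZl_LR /= linear_sumr.
  transitivity (coord X i u * (G *m cokermx G) i j); last first.
    by rewrite mulmx_coker mxE mulr0.
  congr (_ * _); rewrite mxE; apply: eq_bigr => k _.
  by rewrite linearZr_LR /= mulrC; congr (_ * _); rewrite mxE.
exists (\sum_i b 0 i *: X`_i); first by apply: memv_suml => i _; rewrite memvZ.
move=> u /coord_vbasis ->; rewrite linear_sumr linear_sum.
apply: eq_bigr => j _.
rewrite linearZr_LR linearZ /=; congr (_ * _).
transitivity (c 0 j); last by rewrite mxE.
rewrite bG mxE linear_sumlz; apply: eq_bigr => i _.
by rewrite linearZl_LR mxE.
Qed.

(** A vector outside [U] is detected by a coordinate of [\1 - projv U]. Nondegeneracy represents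
    this functional by some [b], which is orthogonal to [U] since the functional vanishes there. *)
Lemma orthovK U : nondegenerate form -> orthov form (orthov form U) = U.
Proof.
move=> /eqP ndeg; apply/eqP; rewrite eqEsubv; apply/andP; split; last first.
  by rewrite orthov_sym.
apply/subvP => x xU; apply: contraT => x'U.
pose p := (\1 - projv U)%VF; pose X := vbasis {:V}.
have px : p x != 0.
  apply: contraNneq x'U; rewrite /p !lfun_simp /= => /eqP; rewrite subr_eq0.
  by move=> /eqP ->; apply: memv_proj.
have [i Xi] : exists i, coord X i (p x) != 0.
  apply/existsP; apply: contraNT px; rewrite negb_exists => /forallP X0.
  rewrite (coord_vbasis (memvf (p x))) big1 // => i _.
  by have /eqP -> := negbNE (X0 i); rewrite scale0r.
have [|b _ bg] := @symform_represent fullv (coord X i \o p).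
  move=> r _ r0; suff -> : r = 0 by rewrite linear0.
  apply/eqP; rewrite -memv0 -ndeg; apply/mem_orthovP => u _.
  by rewrite symformC r0 ?memvf.
case/eqP: Xi; rewrite -[LHS]/((coord X i \o p) x) -bg ?memvf // symformC.
apply: (mem_orthovP xU); apply/mem_orthovP => u uU.
by rewrite bg ?memvf //= /p !lfun_simp projv_id // subrr linear0.
Qed.

End SymmetricForms.

(** * The adjoint representation *)

Section LieTheory.
Variables (K : fieldType) (d : lieAlgType K).
Implicit Types (x y z : d) (U V W k n : {vspace d}).

Lemma lieC x y : [lie x, y] = - [lie y, x].
Proof.
apply/eqP; rewrite -addr_eq0; apply/eqP; have := liexx (x + y).
by rewrite linearDl !linearDr /= !liexx add0r addr0.
Qed.

Lemma lie_lie x y z :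
  [lie x, [lie y, z]] = [lie [lie x, y], z] + [lie y, [lie x, z]].
Proof.
have := lie_jacobi x y z; rewrite (lieC z [lie x, y]) (lieC z x) linearNr /=.
by move/eqP; rewrite subr_eq0 => /eqP <-; rewrite subrK.
Qed.

Lemma liev_sum U V x : x \in liev U V ->
  exists2 s : seq (d * d), {in s, forall ab, ab.1 \in U /\ ab.2 \in V} &
    x = \sum_(ab <- s) [lie ab.1, ab.2].
Proof.
pose X := [seq [lie a, b] | a <- vbasis U, b <- vbasis V].
rewrite /liev -/X => xX; have /coord_span -> : x \in <<in_tuple X>>%VS by [].
elim/big_rec: _ => [|i y _ [s sUV ->]].
  by exists [::] => //; rewrite big_nil.
have /allpairsP[[a b] /= [aU bV ->]] : X`_i \in X by rewrite mem_nth.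
exists ((coord (in_tuple X) i x *: a, b) :: s); last first.
  by rewrite big_cons /= linearZl_LR.
move=> _ /predU1P[-> /= | /sUV //].
by rewrite memvZ ?vbasis_mem // (vbasis_mem aU).
Qed.

Definition normalizes n k := {in n & k, forall x a, [lie x, a] \in k}.

Lemma lievS U U' V V' :
  (U <= U')%VS -> (V <= V')%VS -> (liev U V <= liev U' V')%VS.
Proof.
move=> /subvP UU' /subvP VV'; apply/liev_sub => x y xU yV.
by rewrite memv_lie ?UU' ?VV'.
Qed.

Lemma normalizes_liev n U V :
  normalizes n U -> normalizes n V -> normalizes n (liev U V).
Proof.
move=> nU nV x _ xn /liev_sum[s sUV ->].
rewrite linear_sumr big_seq; apply: memv_suml => ab /sUV[aU bV].
by rewrite /= lie_lie memvD ?memv_lie ?nU ?nV.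
Qed.

(* The matrix of [v |-> [lie v, x]], which acts on rows from the right: this
   choice of sign makes [ad_mx] a morphism of Lie algebras, see [ad_mx_lie]. *)
Definition ad_mx x : 'M[K]_(dim d) :=
  lin1_mx (v2r \o applyr (@lie K d) x \o r2v).

Lemma ad_mxE x v : v2r v *m ad_mx x = v2r [lie v, x].
Proof. by rewrite mul_rV_lin1 /= v2rK. Qed.

Lemma v2r_mx_ext (P Q : 'M[K]_(dim d)) :
  (forall v : d, v2r v *m P = v2r v *m Q) -> P = Q.
Proof.
by move=> PQ; apply/row_matrixP => i; rewrite !rowE -[delta_mx 0 i]r2vK PQ.
Qed.

Lemma ad_mx_is_linear : linear ad_mx.
Proof.
move=> a x y; apply: v2r_mx_ext => v.
by rewrite mulmxDr -scalemxAr !ad_mxE linearPr linearP.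
Qed.
HB.instance Definition _ := GRing.isLinear.Build K d _ _ ad_mx ad_mx_is_linear.

Lemma ad_mx_lie x y :
  ad_mx [lie x, y] = ad_mx x *m ad_mx y - ad_mx y *m ad_mx x.
Proof.
apply: v2r_mx_ext => v; rewrite mulmxBr !mulmxA !ad_mxE -linearB.
by congr (v2r _); rewrite lie_lie (lieC x).
Qed.

Lemma ad_mx_iter x i v :
  v2r v *m ad_mx x ^+ i = v2r (iter i (fun v => [lie v, x]) v).
Proof.
elim: i => [|i IHi]; first by rewrite expr0 mulmx1.
by rewrite exprSr mulmxA IHi ad_mxE.
Qed.

Definition trace_form x y := \tr (ad_mx x *m ad_mx y).

Lemma trace_form_bilinear : bilinear_for *%R *%R trace_form.
Proof.
split=> [z|z] a x y; rewrite /trace_form linearP.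
  by rewrite mulmxDl -scalemxAl linearP.
by rewrite mulmxDr -scalemxAr linearP.
Qed.

Lemma trace_form_sym x y :
  trace_form x y = (-1) ^+ false * idfun (trace_form y x).
Proof. by rewrite expr0 mul1r /trace_form mxtrace_mulC. Qed.
HB.instance Definition _ := bilinear_isBilinear.Build K d d K *%R (idfun \; *%R)
  trace_form trace_form_bilinear.
HB.instance Definition _ := isHermitianSesquilinear.Build K d false idfun
  trace_form trace_form_sym.

Lemma trace_form_invariant : invariant_form trace_form.
Proof.
move=> x y z; rewrite /trace_form !ad_mx_lie mulmxBl mulmxBr !linearB /= mulmxA.
by congr (_ - _); rewrite -mulmxA mxtrace_mulC mulmxA.
Qed.
End LieTheory.

(** * Engel's theorem *)

Section Engel.
Variables (K : fieldType) (d : lieAlgType K).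
Implicit Types (x y z : d) (U V W k n : {vspace d}).

Definition lie_series k i : {vspace d} := iter i (liev k) fullv.

(** Equivalently, all products of [m] operators [ad x] with [x] in [k] vanish: one bound serves the
    whole of [k]. *)
Definition ad_nilpotent k := exists m, lie_series k m = 0%VS.

Lemma lie_seriesS k i : (lie_series k i.+1 <= lie_series k i)%VS.
Proof. by elim: i => [|i IHi]; [apply: subvf | apply: lievS]. Qed.

Lemma normalizes_lie_series n k i :
  normalizes n k -> normalizes n (lie_series k i).
Proof.
move=> nk; elim: i => [|i IHi]; first by move=> x v _ _; apply: memvf.
exact: normalizes_liev.
Qed.

(** On the quotient of [lie_series k i] by the next term [k] acts as zero, so [k + <[y]>] acts there
    through the nilpotent [ad y] alone. *)
Lemma ad_nilpotent_addv_line k y :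
  normalizes <[y]> k -> nilpotent_mx (ad_mx y) ->
  ad_nilpotent k -> ad_nilpotent (k + <[y]>)%VS.
Proof.
move=> nyk [N yN] [m km].
have nyV i v : v \in lie_series k i -> [lie y, v] \in lie_series k i.
  by apply: normalizes_lie_series (memv_line y).
suff kM i : exists M, (lie_series (k + <[y]>) M <= lie_series k i)%VS.
  by have [M] := kM m; rewrite km subv0 => /eqP kyM; exists M.
elim: i => [|i [M kM]]; first by exists 0%N.
pose Y : 'End(d) := linfun (applyr (@lie K d) y).
pose W j := iter j (fun W => Y @: W)%VS (lie_series k i).
have WV j : (W j <= lie_series k i)%VS.
  elim: j => [|j IHj]; first exact: subvv.
  apply/subvP => _ /memv_imgP[u uW ->]; rewrite lfunE /= lieC memvN nyV //.
  exact: (subvP IHj).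
have step j : (lie_series (k + <[y]>) (j + M) <= W j + lie_series k i.+1)%VS.
  elim: j => [|j IHj]; first exact: subv_trans kM (addvSl _ _).
  apply/liev_sub => _ v /memv_addP[a ak [_ /vlineP[c ->] ->]] /(subvP IHj).
  move=> /memv_addP[w wW [v' v'V ->]].
  have wV := subvP (WV j) _ wW.
  have v'V' := subvP (lie_seriesS k i) _ v'V.
  rewrite linearDl /= linearZl_LR /= memvD //.
    by apply: (subvP (addvSr _ _)); rewrite memv_lie // memvD.
  rewrite linearDr /= scalerDr memv_add ?memvZ //; last exact: (nyV i.+1).
  have <- : - Y w = [lie y, w] by rewrite lfunE /= [RHS]lieC.
  by rewrite memvN memv_img.
exists (N + M)%N; apply: subv_trans (step N) _.
rewrite subv_add subvv andbT; apply: subv_trans (sub0v _).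
have WE j v : v \in W j -> exists u, v = iter j (fun u => [lie u, y]) u.
  elim: j v => [|j IHj] v; first by exists v.
  by case/memv_imgP=> _ /IHj[u ->] ->; exists u; rewrite lfunE.
apply/subvP => _ /WE[u ->]; rewrite memv0 -(inj_eq (can_inj v2rK)).
by rewrite -ad_mx_iter yN mulmx0 linear0.
Qed.

(* A proper subalgebra [k'] of [k] acting nilpotently on [d] acts nilpotently on
   [k / k'], hence kills a nonzero class [y]; then [k' + <[y]>] acts nilpotently
   too. *)
Lemma engel k : lie_subalgebra k ->
  {in k, forall x, nilpotent_mx (ad_mx x)} -> ad_nilpotent k.
Proof.
move=> subk nilk.
suff /(_ (\dim k)) : forall j, (j <= \dim k)%N -> exists k',
    [/\ (k' <= k)%VS, lie_subalgebra k', ad_nilpotent k' & (j <= \dim k')%N].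
  case=> // k' [k'k _ nilk' dimk'].
  by suff /eqP <- : k' == k by []; rewrite eqEdim k'k.
elim=> [_|j IHj jk].
  exists 0%VS; split=> //; first exact: sub0v.
    by move=> x y; rewrite !memv0 => /eqP -> _; rewrite linear0l.
  exists 1%N; apply/eqP; rewrite -subv0; apply/liev_sub => x y.
  by rewrite memv0 => /eqP -> _; rewrite linear0l /= mem0v.
have [k' [k'k subk' nilk' dimk']] := IHj (ltnW jk).
have [kk'|kNk'] := boolP (k <= k')%VS.
  by exists k'; split=> //; rewrite (leq_trans jk) // dimvS.
have [m k'm] := nilk'.
have exW : exists i, (iter i (liev k') k <= k')%VS.
  exists m; apply: (@subv_trans _ _ 0%VS); last exact: sub0v.
  rewrite -k'm; elim: (m) => [|i IHi]; first exact: subvf.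
  by apply: lievS.
(* At the last stage before the iterates fall inside [k'], any [y] outside [k'] is sent into [k'] by
   [k']. *)
have [[|i] iW minW] := ex_minnP exW; first by rewrite (negPf kNk') in iW.
have /subvPn[y yW yk'] : ~~ (iter i (liev k') k <= k')%VS.
  by apply/negP => /minW; rewrite ltnn.
have yk : y \in k.
  apply: subvP yW; elim: (i) => [|i' IHi]; first exact: subvv.
  by apply/liev_sub => a b /(subvP k'k) ak /(subvP IHi) bk; apply: subk.
have k'y a : a \in k' -> [lie a, y] \in k'.
  by move=> ak'; apply: (subvP iW); apply: memv_lie.
have y_k' b : b \in k' -> [lie y, b] \in k'.
  by move=> bk'; rewrite lieC memvN k'y.
exists (k' + <[y]>)%VS; split.
- by rewrite subv_add k'k -memvE.
- move=> _ _ /memv_addP[a ak [_ /vlineP[c ->] ->]]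
    /memv_addP[b bk [_ /vlineP[e ->] ->]].
  apply: (subvP (addvSl _ _)).
  rewrite linearDl !linearDr /= !linearZl_LR !linearZr_LR /=.
  rewrite liexx !scaler0 addr0.
  by rewrite !memvD ?memvZ ?k'y ?y_k' //; apply: subk'.
- apply: ad_nilpotent_addv_line => //; last exact: nilk.
  by move=> _ a /vlineP[c ->] ak'; rewrite linearZl_LR /= memvZ // y_k'.
- rewrite dimv_disjoint_sum.
    rewrite dim_vline; suff -> : y != 0 by rewrite addn1 ltnS.
    by apply: contraNneq yk' => ->; rewrite mem0v.
  apply/eqP; rewrite -subv0; apply/subvP => u /memv_capP[uk' /vlineP[c uE]].
  move: uk'; rewrite uE rpredZeq (negPf yk') orbF => /eqP ->.
  by rewrite scale0r mem0v.
Qed.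
End Engel.

(** * Cartan's criterion *)

Section LowerSeries.
Variables (K : fieldType) (d : lieAlgType K).
Implicit Types (x y z : d) (U V W k n : {vspace d}) (P Q : 'M[K]_(dim d)).

(** Stable operators form an algebra in which the raising ones are a two-sided ideal; when [k] is
    [ad_nilpotent] the raising ones are nilpotent, hence of trace zero. *)
Definition series_stable k P := forall i v,
  v \in lie_series k i -> r2v (v2r v *m P) \in lie_series k i.
Definition series_raising k P := forall i v,
  v \in lie_series k i -> r2v (v2r v *m P) \in lie_series k i.+1.

Lemma series_stable_ad n k x :
  normalizes n k -> x \in n -> series_stable k (ad_mx x).
Proof.
move=> nk xn i v vV; rewrite ad_mxE v2rK lieC memvN.
exact: normalizes_lie_series nk _ _ xn vV.
Qed.

Lemma series_raising_ad k x : x \in k -> series_raising k (ad_mx x).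
Proof. by move=> xk i v vV; rewrite ad_mxE v2rK lieC memvN memv_lie. Qed.

Lemma series_stableM k P Q :
  series_stable k P -> series_stable k Q -> series_stable k (P *m Q).
Proof. by move=> sP sQ i v /sP/sQ; rewrite r2vK mulmxA. Qed.

Lemma series_stableX k P j : series_stable k P -> series_stable k (P ^+ j).
Proof.
move=> sP; elim: j => [|j IHj].
  by move=> i v vV; rewrite expr0 mulmx1 v2rK.
by rewrite exprS; apply: series_stableM.
Qed.

Lemma series_raisingMl k P Q :
  series_raising k P -> series_stable k Q -> series_raising k (P *m Q).
Proof. by move=> rP sQ i v /rP/sQ; rewrite r2vK mulmxA. Qed.

Lemma series_raisingMr k P Q :
  series_stable k P -> series_raising k Q -> series_raising k (P *m Q).
Proof. by move=> sP rQ i v /sP/rQ; rewrite r2vK mulmxA. Qed.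

Lemma series_raisingD k P Q :
  series_raising k P -> series_raising k Q -> series_raising k (P + Q).
Proof. by move=> rP rQ i v vV; rewrite mulmxDr linearD memvD ?rP ?rQ. Qed.

Lemma series_raising_mxtrace0 k P :
  ad_nilpotent k -> series_raising k P -> \tr P = 0.
Proof.
move=> [m km] rP; apply: (@mxtrace_nilpotent _ _ _ m); apply: v2r_mx_ext => v.
rewrite mulmx0; apply: (can_inj r2vK); rewrite linear0.
apply/eqP; rewrite -memv0 -km.
elim: (m) => [|i IHi]; first exact: memvf.
by have := rP _ _ IHi; rewrite r2vK -mulmxA mulmxE -exprSr.
Qed.

Lemma trace_form_ad_nilpotent n k : normalizes n k -> ad_nilpotent k ->
  {in k & n, forall a x, trace_form a x = 0}.
Proof.
move=> nk nilk a x ak xn; apply: series_raising_mxtrace0 nilk _.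
apply: series_raisingMl; first exact: series_raising_ad.
exact: series_stable_ad nk xn.
Qed.

Section Characteristic0.
Variables (C : numClosedFieldType) (f : {rmorphism K -> C}).

(* All the traces of powers of [ad_mx s] vanish: cyclicity turns
   [\tr ([ad a, ad b] *m S ^+ j)] into [\tr (ad a *m [ad b, S ^+ j])], where
   [S = ad_mx s] commutes with [ad b] up to a matrix raising the series. *)
Lemma nilpotent_lie_sum n k s (r : seq (d * d)) :
  normalizes n k -> ad_nilpotent k -> s \in n ->
  {in r, forall ab, [/\ ab.1 \in n, ab.2 \in n & [lie ab.2, s] \in k]} ->
  s = \sum_(ab <- r) [lie ab.1, ab.2] -> nilpotent_mx (ad_mx s).
Proof.
move=> nk nilk sn rP sE; apply: (nilpotent_mxtrace_exp f) => j.
rewrite exprS {1}sE linear_sum mulr_suml linear_sum big_seq.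
rewrite big1 //= => -[a b] /rP[/= an bn bsk].
rewrite ad_mx_lie -mulmxE mulmxBl linearB /= -mulmxA -(mulmxA (ad_mx b)).
rewrite (mxtrace_mulC (ad_mx b)) -mulmxA -linearB -mulmxBr.
apply: series_raising_mxtrace0 nilk _; apply: series_raisingMr.
  exact: series_stable_ad nk an.
elim: j => [|j IHj].
  by move=> i v _; rewrite expr0 mulmx1 mul1mx subrr mulmx0 linear0 mem0v.
(* Leibniz rule for the commutator with [ad b]; the first term raises the series because [[b, s]] is
   in [k]. *)
have -> : ad_mx b *m ad_mx s ^+ j.+1 - ad_mx s ^+ j.+1 *m ad_mx b =
    ad_mx [lie b, s] *m ad_mx s ^+ j +
    ad_mx s *m (ad_mx b *m ad_mx s ^+ j - ad_mx s ^+ j *m ad_mx b).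
  rewrite ad_mx_lie exprS -mulmxE mulmxBl mulmxBr !mulmxA.
  by rewrite addrA subrK.
have ss := series_stable_ad nk sn.
apply: series_raisingD; last exact: series_raisingMr.
by apply: series_raisingMl; [apply: series_raising_ad|apply: series_stableX].
Qed.

(** Engel's theorem reduces this to one [x] in [liev U U], a sum of brackets [[a, b]]. Bracketing
    [b] at least once with [x] gives an element of [liev U U], so the traces required by
    [nilpotent_mx_commutators] vanish. *)
Lemma cartan_criterion U : lie_subalgebra U ->
  {in U & liev U U, forall a b, trace_form a b = 0} -> ad_nilpotent (liev U U).
Proof.
move=> subU trU.
have UU : (liev U U <= U)%VS by apply/liev_sub.
apply: engel => [x y xUU yUU|x xUU].
  by rewrite memv_lie ?(subvP UU).
have [s sU xE] := liev_sum xUU.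
pose t := [seq (ad_mx ab.1, ad_mx ab.2) | ab <- s].
apply: (nilpotent_mx_commutators f (s := t)).
  rewrite {1}xE linear_sum big_map; apply: eq_bigr => ab _.
  exact: ad_mx_lie.
move=> _ /mapP[[a b] /sU[/= aU bU] ->] j /=.
pose c := iter j.+1 (fun z => [lie x, z]) b.
have cUU : c \in liev U U.
  rewrite /c; elim: j {c} => [|j IHj]; first by rewrite memv_lie // (subvP UU).
  by rewrite iterS memv_lie ?(subvP UU).
have -> i : iter i (fun M => ad_mx x *m M - M *m ad_mx x) (ad_mx b) =
    ad_mx (iter i (fun z => [lie x, z]) b).
  by elim: i => //= i ->; rewrite ad_mx_lie.
by rewrite -ad_mx_lie; apply: trU.
Qed.
End Characteristic0.
End LowerSeries.

(** * Reductive Lie algebras *)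

Section Reductive.
Variables (K : fieldType) (d : lieAlgType K).
Variables (C : numClosedFieldType) (f : {rmorphism K -> C}).
Implicit Types (x y z : d) (U V W k n m : {vspace d}).
Local Notation Kf := (@trace_form K d).

Lemma ideal_normalizes U : lie_ideal U -> normalizes fullv U.
Proof. by move=> idU x u _ uU; apply: idU. Qed.

Lemma normalizes_orthov n U (form : {symmetric d}) : invariant_form form ->
  normalizes n U -> normalizes n (orthov form U).
Proof.
move=> inv nU x a xn /mem_orthovP aU; apply/mem_orthovP => u uU.
by rewrite lieC linearNl /= inv aU ?oppr0 // nU.
Qed.

Lemma lie_disjoint_ideals U V x y :
  lie_ideal U -> lie_ideal V -> (U :&: V = 0)%VS ->
  x \in U -> y \in V -> [lie x, y] = 0.
Proof.
move=> idU idV UV0 xU yV; apply/eqP; rewrite -memv0 -UV0.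
by apply/memv_capP; split; [rewrite lieC memvN idU | rewrite idV].
Qed.

(* The derived algebra of the radical acts nilpotently by Cartan's criterion,
   and having an ideal complement it is perfect, so it vanishes; the radical is
   then an abelian ideal with an ideal complement. *)
Lemma reductive_radical_central : reductive d ->
  {in orthov Kf fullv, forall r x, [lie r, x] = 0}.
Proof.
move=> red; set R := orthov Kf fullv.
have idR : lie_ideal R.
  move=> x r; apply: normalizes_orthov (memvf x).
    exact: trace_form_invariant.
  by move=> ? ? _ _; apply: memvf.
have idRR : lie_ideal (liev R R).
  move=> x y; apply: normalizes_liev (memvf x); exact: ideal_normalizes.
have RR0 : liev R R = 0%VS.
  have [m Rm] : ad_nilpotent (liev R R).
    apply: (cartan_criterion f) => [x y _ yR|a b aR _]; first exact: idR.
    by apply: (mem_orthovP aR); apply: memvf.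
  have [V [idV RV RV0]] := red _ idRR.
  (* Brackets split along [liev R R] and [V]; the component of [[a, b]] in [V] is also in
     [liev R R], hence zero. *)
  have RRR : (liev R R <= liev (liev R R) (liev R R))%VS.
    apply/liev_sub => a b aR bR.
    have := memvf a; rewrite -RV => /memv_addP[a1 a1R [a2 a2V aE]].
    have := memvf b; rewrite -RV => /memv_addP[b1 b1R [b2 b2V bE]].
    have abE : [lie a, b] = [lie a1, b1] + [lie a2, b2].
      have lie0 := lie_disjoint_ideals idRR idV RV0.
      rewrite aE bE linearDl !linearDr /= (lie0 a1 b2) // [[lie a2, b1]]lieC.
      by rewrite (lie0 b1 a2) // oppr0 addr0 add0r.
    suff ab2 : [lie a2, b2] = 0 by rewrite abE ab2 addr0 memv_lie.
    apply/eqP; rewrite -memv0 -RV0; apply/memv_capP; split; last exact: idV.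
    have -> : [lie a2, b2] = [lie a, b] - [lie a1, b1].
      by rewrite abE addrC addKr.
    by apply: memvB; [apply: memv_lie | apply: idRR].
  (* Being perfect, [liev R R] stays inside every term of its own series, including the zero one. *)
  apply/eqP; rewrite -subv0 -Rm; elim: (m) => [|i IHi]; first exact: subvf.
  by apply: subv_trans RRR _; apply: lievS.
have [V [idV RV RV0]] := red _ idR.
move=> r rR x; have := memvf x; rewrite -RV => /memv_addP[x1 x1R [x2 x2V ->]].
rewrite linearDr /= (lie_disjoint_ideals idR idV RV0 rR x2V) addr0.
by apply/eqP; rewrite -memv0 -RR0 memv_lie.
Qed.

(** [Kf] is nondegenerate on an ideal complement [V] of its radical [R], so [form v] agrees on [V]
    with [Kf (phi v)]; invariance of both forms makes [phi] commute with [ad]. On [R], which is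
    central, both sides vanish for [w] a sum of brackets. *)
Lemma reductive_trace_form (form : {symmetric d}) :
  reductive d -> invariant_form form ->
  exists P : 'M[K]_(dim d), (forall x, ad_mx x *m P = P *m ad_mx x) /\
    (forall w y, w \in liev fullv fullv -> form w y = Kf (r2v (v2r w *m P)) y).
Proof.
move=> red inv; have central := reductive_radical_central red.
have invK := @trace_form_invariant K d.
set R := orthov Kf fullv in central.
have KC x y : Kf x y = Kf y x by apply: mxtrace_mulC.
have KR r x : r \in R -> Kf r x = 0.
  by move=> /mem_orthovP; apply; apply: memvf.
have idR : lie_ideal R.
  by move=> x r rR; rewrite lieC central // oppr0 mem0v.
have [V [idV RV RV0]] := red _ idR.
have split_R x : exists2 r, r \in R & exists2 v, v \in V & x = r + v.
  by apply/memv_addP; rewrite RV memvf.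
have KV z : z \in V -> {in V, forall u, Kf z u = 0} -> z = 0.
  move=> zV zV0; apply/eqP; rewrite -memv0 -RV0; apply/memv_capP; split=> //.
  apply/mem_orthovP => x _; have [r rR [v vV ->]] := split_R x.
  by rewrite linearDr /= (zV0 v vV) addr0 KC KR.
have repr v : exists b, b \in V /\ {in V, forall u, Kf b u = form v u}.
  have [|b bV bu] := symform_represent (form := Kf) (U := V) (g := form v).
    move=> r rV r0; rewrite (KV r) ?linear0 // => u uV.
    by rewrite KC; apply: r0.
  by exists b.
(* Representatives are chosen on a basis only, so that [phi] is linear by construction. *)
have [b bP] := fin_all_exists (fun i : 'I_(dim d) => repr (r2v (delta_mx 0 i))).
pose P := \matrix_i v2r (b i); pose phi (v : d) : d := r2v (v2r v *m P).
have phiE v : phi v = \sum_i v2r v 0 i *: b i.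
  rewrite /phi mulmx_sum_row linear_sum; apply: eq_bigr => i _.
  by rewrite linearZ /= rowK v2rK.
have phiV v : phi v \in V.
  by rewrite phiE; apply: memv_suml => i _; rewrite memvZ //; case: (bP i).
have Kphi v u : u \in V -> Kf (phi v) u = form v u.
  have vE : v = \sum_i v2r v 0 i *: r2v (delta_mx 0 i).
    rewrite -[LHS]v2rK {1}[v2r v]row_sum_delta linear_sum.
    by apply: eq_bigr => i _; rewrite linearZ.
  move=> uV; rewrite phiE [in RHS]vE !linear_sumlz.
  apply: eq_bigr => i _; rewrite !linearZl_LR /=; congr (_ * _).
  by have [_ bi] := bP i; apply: bi.
have phi_lie x v : phi [lie x, v] = [lie x, phi v].
  apply/eqP; rewrite -subr_eq0; apply/eqP; apply: KV => [|u uV].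
    by rewrite memvB // idV.
  rewrite linearBl /= Kphi // (lieC x v) (lieC x (phi v)) !linearNl /=.
  by rewrite inv invK Kphi ?idV // subrr.
exists P; split=> [x|w y wdd].
  apply: v2r_mx_ext => v; rewrite !mulmxA ad_mxE; apply: (can_inj r2vK).
  rewrite -[LHS]/(phi _) -[v2r v *m P]r2vK -/(phi v) ad_mxE v2rK.
  by rewrite lieC [RHS]lieC -phi_lie /phi !linearN mulNmx linearN.
have [r rR [u uV ->]] := split_R y.
rewrite !linearDr /= -/(phi w) (Kphi w u uV) (KC _ r) KR // [RHS]add0r.
have [s sdd ->] := liev_sum wdd.
rewrite linear_sumlz big1 ?add0r // => ab _.
by rewrite /= inv lieC central // oppr0 linear0r.
Qed.

Lemma series_stable_comm k (P : 'M[K]_(dim d)) :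
  (forall x, ad_mx x *m P = P *m ad_mx x) -> series_stable k P.
Proof.
move=> comP; elim=> [|i IHi] v vV; first exact: memvf.
have [s skV ->] := liev_sum vV.
rewrite linear_sum mulmx_suml linear_sum big_seq.
apply: memv_suml => -[a u] /skV[/= ak uV].
rewrite /= lieC linearN mulNmx linearN memvN /= -ad_mxE -mulmxA comP mulmxA.
by rewrite -[v2r u *m P]r2vK ad_mxE v2rK lieC memvN memv_lie ?IHi.
Qed.

(** The value [form w y] is the trace of [ad w *m P *m ad y], whose first factor raises the series
    of [k] while the other two preserve it. *)
Lemma form_ad_nilpotent (form : {symmetric d}) n k :
  reductive d -> invariant_form form ->
  normalizes n k -> ad_nilpotent k -> (k <= liev fullv fullv)%VS ->
  {in k & n, forall w y, form w y = 0}.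
Proof.
move=> red inv nk nilk kdd w y wk yn.
have [P [comP formP]] := reductive_trace_form red inv.
rewrite formP ?(subvP kdd) //.
have adP : ad_mx (r2v (v2r w *m P)) = ad_mx w *m P.
  apply: v2r_mx_ext => v; rewrite mulmxA !ad_mxE (lieC v) linearN /=.
  rewrite -(ad_mxE v) r2vK -mulmxA -comP mulmxA ad_mxE (lieC w).
  by rewrite linearN /= mulNmx opprK.
rewrite /trace_form adP; apply: series_raising_mxtrace0 nilk _.
apply: series_raisingMl; last exact: series_stable_ad nk yn.
apply: series_raisingMl; first exact: series_raising_ad.
exact: series_stable_comm.
Qed.

Lemma liev_ideal_decomposition (form : {symmetric d}) n m :
  reductive d -> invariant_form form -> lie_subalgebra n ->
  (m <= n)%VS -> normalizes n m ->
  (liev n m <= liev n (liev m m) + orthov form n)%VS.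
Proof.
move=> red inv subn mn nm; have invK := @trace_form_invariant K d.
have mm : normalizes m m by move=> x y /(subvP mn) xn ym; apply: nm.
pose m' := liev m m; pose c := (m :&: orthov Kf m')%VS.
have m'm : (m' <= m)%VS by apply/liev_sub.
have nm' : normalizes n m' by apply: normalizes_liev.
have cm : (c <= m)%VS by apply: capvSl.
have nc : normalizes n c.
  move=> x a xn /memv_capP[am aK]; apply/memv_capP; split; first exact: nm.
  exact: (normalizes_orthov invK nm').
have Kc a u : a \in c -> u \in m' -> Kf a u = 0.
  by case/memv_capP=> _ /mem_orthovP; apply.
(* Cartan's criterion applies as [c] is [Kf]-orthogonal to [m'], which contains [liev c c]. *)
have nil1 : ad_nilpotent (liev c c).
  apply: (cartan_criterion f) => [x y xc yc|a b ac bcc].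
    by apply: nc => //; rewrite (subvP mn) // (subvP cm).
  by apply: Kc => //; apply: subvP bcc; apply: lievS.
(* Here [s] is a sum of [[a, b]] with [b] in [c] and lies in [c] itself, so [[b, s]] is in
   [liev c c]. *)
have nil2 : ad_nilpotent (liev n c).
  have ncc : (liev n c <= c)%VS by apply/liev_sub.
  apply: engel => [x y xnc ync|s snc].
    by rewrite memv_lie ?(subvP ncc) // (subvP mn) // (subvP cm) // (subvP ncc).
  have [r rnc sE] := liev_sum snc.
  have cn a : a \in c -> a \in n by move/(subvP cm)/(subvP mn).
  apply: (nilpotent_lie_sum f (n := n)) nil1 _ _ sE.
  - exact: normalizes_liev.
  - exact/cn/(subvP ncc).
  move=> ab /rnc[an bc]; split=> //; first exact: cn.
  by rewrite memv_lie // (subvP ncc).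
have nnc : normalizes n (liev n c) by apply: normalizes_liev.
(* The same argument one level up: [b] is in [m] and [s] in [c], so [[b, s]] is in [liev n c]. *)
have nil3 : ad_nilpotent (m' :&: c)%VS.
  apply: engel => [x y|s] /memv_capP[xm' xc].
    move=> /memv_capP[ym' yc].
    have xn : x \in n by rewrite (subvP mn) // (subvP cm).
    by apply/memv_capP; split; [apply: nm' | apply: nc].
  have [r rmm sE] := liev_sum xm'.
  apply: (nilpotent_lie_sum f nnc nil2 _ _ sE).
    by rewrite (subvP mn) // (subvP cm).
  move=> ab /rmm[am bm]; split; rewrite ?(subvP mn) //.
  by rewrite memv_lie // (subvP mn).
have n3 : normalizes n (m' :&: c)%VS.
  move=> x y xn /memv_capP[ym' yc].
  by apply/memv_capP; split; [apply: nm' | apply: nc].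
(* The radical of [Kf] on [m'] is [m' :&: c], orthogonal to [a] by [nil3]; hence some [b] in [m']
   represents [Kf a] on [m']. *)
have split_m a : a \in m -> exists2 b, b \in m' & a - b \in c.
  move=> am; have [|b bm' bE] := symform_represent (form := Kf) (U := m')
    (g := (Kf : {symmetric d}) a).
    move=> r rm' r0; rewrite -[LHS]/(Kf a r) symformC.
    apply: (trace_form_ad_nilpotent n3 nil3); last by rewrite (subvP mn).
    apply/memv_capP; split=> //; apply/memv_capP; split.
      exact: (subvP m'm).
    by apply/mem_orthovP => u um'; rewrite symformC; apply: r0.
  exists b => //; apply/memv_capP; split; first by rewrite memvB // (subvP m'm).
  by apply/mem_orthovP => u um'; rewrite linearBl /= bE // subrr.
apply/liev_sub => x a xn /split_m[b bm' abc].
rewrite -(subrK b a) linearDr /= addrC memv_add ?memv_lie //.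
apply/mem_orthovP => y yn; apply: (form_ad_nilpotent red inv nnc nil2) => //.
  by apply: lievS; apply: subvf.
exact: memv_lie.
Qed.

Lemma lagrangian_normalizer_bracket (form : {symmetric d}) l :
  reductive d -> nondegenerate form -> invariant_form form ->
  lagrangian form l ->
  liev (lie_normv l) (lie_normv l) = orthov form (lie_normv l).
Proof.
move=> red ndeg inv [subl lE]; set n := lie_normv l.
have nl : normalizes n l by move=> x a /memv_lie_normv nx /nx.
have ln : (l <= n)%VS.
  by apply/subvP => x xl; apply/memv_lie_normv => y yl; apply: subl.
have subn : lie_subalgebra n.
  move=> x y xn yn; apply/memv_lie_normv => a al.
  have -> : [lie [lie x, y], a] = [lie x, [lie y, a]] - [lie y, [lie x, a]].
    by rewrite lie_lie addrK.
  by rewrite memvB ?nl.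
have form_l a b : a \in l -> b \in l -> form a b = 0.
  by rewrite -{1}lE => /mem_orthovP; apply.
have lln : (liev l l <= orthov form n)%VS.
  apply/liev_sub => a b al bl; apply/mem_orthovP => x xn.
  by rewrite inv form_l // lieC memvN nl.
have nln : (liev n l <= orthov form n)%VS.
  apply: subv_trans (liev_ideal_decomposition red inv subn ln nl) _.
  rewrite subv_add subvv andbT; apply: subv_trans lln.
  by apply/liev_sub; apply: normalizes_liev.
have nnl : (liev n n <= l)%VS.
  apply/liev_sub => x y xn yn; rewrite -lE; apply/mem_orthovP => a al.
  rewrite inv symformC; apply: (mem_orthovP _ _ xn).
  by apply: (subvP nln); apply: memv_lie.
apply/eqP; rewrite eqEsubv; apply/andP; split.
  apply: subv_trans (liev_ideal_decomposition red inv subn (subvv n) subn) _.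
  rewrite subv_add subvv andbT; apply: subv_trans nln; exact: lievS.
apply: (@subv_trans _ _ (liev l l)); last exact: lievS.
(* Passing to orthogonals, the claim becomes that every vector orthogonal to [liev l l] normalizes
   [l]. *)
rewrite -[liev l l](orthovK _ ndeg) orthov_sym orthovK //.
apply/subvP => x /mem_orthovP xll; apply/memv_lie_normv => y yl.
rewrite -lE; apply/mem_orthovP => z zl.
by rewrite inv xll // memv_lie.
Qed.
End Reductive.

Theorem proposition3p3 (R : realType) :
  (forall (d : lieAlgType R) (form : {symmetric d}),
     ~~ odd (\dim {: d}) -> reductive d ->
     nondegenerate form -> invariant_form form ->
     forall l : {vspace d}, lagrangian form l ->
     liev (lie_normv l) (lie_normv l) = orthov form (lie_normv l)) /\
  (forall (d : lieAlgType R[i]) (form : {symmetric d}),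
     ~~ odd (\dim {: d}) -> reductive d ->
     nondegenerate form -> invariant_form form ->
     forall l : {vspace d}, lagrangian form l ->
     liev (lie_normv l) (lie_normv l) = orthov form (lie_normv l)).
Proof.
split=> d form _ red ndeg inv l lag.
  (* The trace criteria ask for a morphism from the base field to an algebraically closed field with
     conjugation: the embedding into [R[i]] for [R], the identity for [R[i]]. *)
  exact: (lagrangian_normalizer_bracket (real_complex R)).
exact: (lagrangian_normalizer_bracket idfun).
Qed.
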